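(* Let $p$ be a prime and $n\geq1$ an integer. The set $$\{P^i\,\chi P^{n-i}: l(n)+1\leq i\leq n\}$$ is linearly independent over $\mathbb{F}_p$ in $\mathcal{P}^n$.
   Context: $\mathcal{P}$ denotes the Hopf algebra over $\mathbb{F}_p$ of Steenrod reduced powers: for $p$ odd, the subalgebra of the mod $p$ Steenrod algebra generated by the reduced powers $P^n$, $n\ge0$ ($P^0=1$); for $p=2$, $P^n$ denotes $\mathrm{Sq}^n$ and $\mathcal{P}$ is the full mod $2$ Steenrod algebra. It is graded so that $P^n$ has degree $n$, and $\mathcal{P}^n$ denotes the degree $n$ part. The coproduct is determined by $\Delta P^n=\sum_i P^i\otimes P^{n-i}$. The map $\chi$ is the Hopf algebra anti-automorphism of $\mathcal{P}$, determined by $\chi P^0=P^0$ and $\sum_{i=0}^n P^i\,\chi P^{n-i}=0$ for $n>0$. For an integer $j\geq0$, $\alpha(j)$ is the sum of the digits of the base-$p$ expansion of $j$. For $n\geq1$, $$l(n)=\max\{j\geq0: pj-\alpha(j)<(p-1)n\}.$$ The set is understood as a family indexed by $i$. *)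

(* Defs.v *)
From HB Require Import structures.
From mathcomp Require Import all_boot all_order all_algebra.
From mathcomp Require Import boolp.
From mathcomp.multinomials Require Import monalg.

Set Implicit Arguments.
Unset Strict Implicit.
Unset Printing Implicit Defensive.

Import GRing.Theory.
Local Open Scope ring_scope.
Local Open Scope quotient_scope.

Section TwoSidedIdeal.

Variables (R : nzRingType) (rel : R -> Prop).

Inductive two_sided_ideal : R -> Prop :=
| Ideal0 : two_sided_ideal 0
| IdealMD u r v x :
    rel r -> two_sided_ideal x -> two_sided_ideal (u * r * v + x).

Lemma ideal_gen r : rel r -> two_sided_ideal r.
Proof.
by move=> hr; rewrite -[r]addr0 -[r]mul1r -[1 * r]mulr1; apply/IdealMD/Ideal0.
Qed.

Lemma idealD x y :
  two_sided_ideal x -> two_sided_ideal y -> two_sided_ideal (x + y).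
Proof.
move=> hx hy; elim: hx => [|u r v {}x hr _ IH]; first by rewrite add0r.
by rewrite -addrA; apply: IdealMD.
Qed.

Lemma idealMl a x : two_sided_ideal x -> two_sided_ideal (a * x).
Proof.
elim=> [|u r v {}x hr _ IH]; first by rewrite mulr0; apply: Ideal0.
by rewrite mulrDr !mulrA; apply: IdealMD.
Qed.

Lemma idealMr a x : two_sided_ideal x -> two_sided_ideal (x * a).
Proof.
elim=> [|u r v {}x hr _ IH]; first by rewrite mul0r; apply: Ideal0.
by rewrite mulrDl -[_ * v * a]mulrA; apply: IdealMD.
Qed.

Lemma idealB x y :
  two_sided_ideal x -> two_sided_ideal y -> two_sided_ideal (x - y).
Proof. by move=> hx hy; apply: idealD => //; rewrite -mulN1r; apply: idealMl. Qed.

Lemma idealBM x x' y y' : two_sided_ideal (x - x') ->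
  two_sided_ideal (y - y') -> two_sided_ideal (x * y - x' * y').
Proof.
move=> hx hy; rewrite -[x * y](subrK (x' * y)) -mulrBl -addrA -mulrBr.
by apply: idealD; [apply: idealMr | apply: idealMl].
Qed.

End TwoSidedIdeal.

Section QuotientAlgebra.

Variables (K : nzRingType) (A : lalgType K) (rel : A -> Prop).
Hypothesis ideal_proper : ~ two_sided_ideal rel 1.

Definition ideal_pred : pred A := fun x => `[< two_sided_ideal rel x >].

Lemma ideal_predP x : reflect (two_sided_ideal rel x) (x \in ideal_pred).
Proof. exact: asboolP. Qed.

Lemma ideal_pred_zmod_closed : zmod_closed ideal_pred.
Proof.
split=> [|x y /ideal_predP hx /ideal_predP hy]; apply/ideal_predP.
  exact: Ideal0.
exact: idealB.
Qed.

HB.instance Definition _ :=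
  GRing.isZmodClosed.Build A ideal_pred ideal_pred_zmod_closed.

Definition ideal_zmod : zmodClosed A := GRing.ZmodClosed.clone _ ideal_pred _.

(* The quotient of A by the two-sided ideal generated by rel; ideal_proper is
   a parameter because nzRingType requires 1 != 0. *)
Definition quot_alg (_ : ~ two_sided_ideal rel 1) := {ideal_quot ideal_zmod}.

Local Notation Q := (quot_alg ideal_proper).

HB.instance Definition _ := EqQuotient.on Q.
HB.instance Definition _ := GRing.Zmodule.on Q.

Lemma quot_alg_eqP (x y : A) :
  reflect (x = y %[mod Q]) (x - y \in ideal_pred).
Proof. by rewrite Quotient.idealrBE; apply: eqP. Qed.

Lemma quot_alg_repr (x : A) : two_sided_ideal rel (x - repr (\pi_Q x)).
Proof. by apply/ideal_predP/quot_alg_eqP; rewrite reprK. Qed.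

Definition quot_alg_one : Q := \pi_Q 1.
Definition quot_alg_mul := lift_op2 Q *%R.
Definition quot_alg_scale (c : K) := lift_op1 Q ( *:%R c).

Lemma pi_quot_algD : {morph \pi_Q : x y / x + y}.
Proof. by move=> x y; rewrite !piE. Qed.

Lemma pi_quot_algM : {morph \pi_Q : x y / x * y >-> quot_alg_mul x y}.
Proof.
move=> x y; unlock quot_alg_mul.
by apply/quot_alg_eqP/ideal_predP/idealBM; apply: quot_alg_repr.
Qed.

Lemma pi_quot_algZ c : {morph \pi_Q : x / c *: x >-> quot_alg_scale c x}.
Proof.
move=> x; unlock quot_alg_scale; apply/quot_alg_eqP/ideal_predP.
by rewrite -scalerBr -[_ - _]mul1r scalerAl; apply/idealMl/quot_alg_repr.
Qed.

Lemma quot_alg_mulA : associative quot_alg_mul.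
Proof.
elim/quotW=> x; elim/quotW=> y; elim/quotW=> z.
by rewrite -!pi_quot_algM mulrA.
Qed.

Lemma quot_alg_mul1l : left_id quot_alg_one quot_alg_mul.
Proof. by elim/quotW=> x; rewrite -pi_quot_algM mul1r. Qed.

Lemma quot_alg_mul1r : right_id quot_alg_one quot_alg_mul.
Proof. by elim/quotW=> x; rewrite -pi_quot_algM mulr1. Qed.

Lemma quot_alg_mulDl : left_distributive quot_alg_mul +%R.
Proof.
elim/quotW=> x; elim/quotW=> y; elim/quotW=> z.
by rewrite -pi_quot_algD -!pi_quot_algM mulrDl pi_quot_algD.
Qed.

Lemma quot_alg_mulDr : right_distributive quot_alg_mul +%R.
Proof.
elim/quotW=> x; elim/quotW=> y; elim/quotW=> z.
by rewrite -pi_quot_algD -!pi_quot_algM mulrDr pi_quot_algD.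
Qed.

Lemma quot_alg_one_neq0 : quot_alg_one != 0.
Proof.
apply/eqP => e1; apply: ideal_proper; apply/ideal_predP.
by rewrite -[1]subr0; apply/quot_alg_eqP; rewrite [LHS]e1 !piE.
Qed.

HB.instance Definition _ := GRing.Zmodule_isNzRing.Build Q
  quot_alg_mulA quot_alg_mul1l quot_alg_mul1r quot_alg_mulDl quot_alg_mulDr
  quot_alg_one_neq0.

Lemma quot_alg_scaleA c d x :
  quot_alg_scale c (quot_alg_scale d x) = quot_alg_scale (c * d) x.
Proof. by elim/quotW: x => x; rewrite -!pi_quot_algZ scalerA. Qed.

Lemma quot_alg_scale1 : left_id 1 quot_alg_scale.
Proof. by elim/quotW=> x; rewrite -pi_quot_algZ scale1r. Qed.

Lemma quot_alg_scaleDr : right_distributive quot_alg_scale +%R.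
Proof.
move=> c; elim/quotW=> x; elim/quotW=> y.
by rewrite -pi_quot_algD -!pi_quot_algZ scalerDr pi_quot_algD.
Qed.

Lemma quot_alg_scaleDl x : {morph quot_alg_scale^~ x : c d / c + d}.
Proof.
by elim/quotW: x => x c d; rewrite -!pi_quot_algZ scalerDl pi_quot_algD.
Qed.

HB.instance Definition _ := GRing.Zmodule_isLmodule.Build K Q
  quot_alg_scaleA quot_alg_scale1 quot_alg_scaleDr quot_alg_scaleDl.

Lemma quot_alg_scaleAl (c : K) (x y : Q) : c *: (x * y) = c *: x * y.
Proof.
elim/quotW: x => x; elim/quotW: y => y.
change (quot_alg_scale c (quot_alg_mul (\pi_Q x) (\pi_Q y))
  = quot_alg_mul (quot_alg_scale c (\pi_Q x)) (\pi_Q y)).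
by rewrite -pi_quot_algM -!pi_quot_algZ -pi_quot_algM scalerAl.
Qed.

HB.instance Definition _ := GRing.Lmodule_isLalgebra.Build K Q
  quot_alg_scaleAl.

Definition quot_alg_pi (x : A) : Q := \pi_Q x.

Lemma quot_alg_pi_zmod_morphism : zmod_morphism quot_alg_pi.
Proof. by move=> x y; rewrite /quot_alg_pi !piE. Qed.

Lemma quot_alg_pi_monoid_morphism : monoid_morphism quot_alg_pi.
Proof. by split=> // x y; apply: pi_quot_algM. Qed.

Lemma quot_alg_pi_scalable : scalable quot_alg_pi.
Proof. by move=> c x; apply: pi_quot_algZ. Qed.

HB.instance Definition _ :=
  GRing.isZmodMorphism.Build A Q quot_alg_pi quot_alg_pi_zmod_morphism.
HB.instance Definition _ :=
  GRing.isMonoidMorphism.Build A Q quot_alg_pi quot_alg_pi_monoid_morphism.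
HB.instance Definition _ :=
  GRing.isScalable.Build K A Q *:%R quot_alg_pi quot_alg_pi_scalable.

Lemma quot_alg_piP x y :
  quot_alg_pi x = quot_alg_pi y <-> two_sided_ideal rel (x - y).
Proof. by split=> [/quot_alg_eqP/ideal_predP|/ideal_predP/quot_alg_eqP]. Qed.

Lemma quot_alg_piW (P : Q -> Prop) :
  (forall x, P (quot_alg_pi x)) -> forall x, P x.
Proof. exact: quotW. Qed.

End QuotientAlgebra.

Variant steenrod_gen : Type := Bockstein | Power of nat.

Definition steenrod_gen_code (g : steenrod_gen) : option nat :=
  if g is Power n then Some n else None.
Definition steenrod_gen_decode (o : option nat) : steenrod_gen :=
  if o is Some n then Power n else Bockstein.
Lemma steenrod_gen_codeK : cancel steenrod_gen_code steenrod_gen_decode.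
Proof. by case. Qed.

HB.instance Definition _ := Countable.copy steenrod_gen (can_type steenrod_gen_codeK).

Section SteenrodAlgebra.

Variable p : nat.

(* {fmonom T} is the free (noncommutative) monoid on T, so this is the free
   associative algebra on the generators. *)
Definition steenrod_free := {malg 'F_p[{fmonom steenrod_gen}]}.

HB.instance Definition _ := GRing.Lalgebra.on steenrod_free.

Definition free_beta : steenrod_free := << fmu Bockstein >>.
Definition free_P (n : nat) : steenrod_free := << fmu (Power n) >>.

(* Adem relations.  The conditions on the sums keep every truncated
   subtraction exact.  For p = 2 the signs disappear, the second relation is
   the Adem relation for Sq^a Sq^b, and the Bockstein is Sq^1. *)
Inductive adem_rel : steenrod_free -> Prop :=
| AdemP0 : adem_rel (free_P 0 - 1)
| AdemPP a b : (a < p * b)%N ->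
    adem_rel (free_P a * free_P b
      - \sum_(0 <= j < a.+1 | (p * j <= a)%N)
          ((-1) ^+ (a + j) *+ 'C((p - 1) * (b - j) - 1, a - p * j))
            *: (free_P (a + b - j) * free_P j))
| AdemBB : odd p -> adem_rel (free_beta * free_beta)
| AdemPBP a b : odd p -> (a <= p * b)%N ->
    adem_rel (free_P a * free_beta * free_P b
      - (\sum_(0 <= j < a.+1 | (p * j <= a)%N)
           ((-1) ^+ (a + j) *+ 'C((p - 1) * (b - j), a - p * j))
             *: (free_beta * free_P (a + b - j) * free_P j)
         - \sum_(0 <= j < a.+1 | (p * j < a)%N)
             ((-1) ^+ (a + j) *+ 'C((p - 1) * (b - j) - 1, a - p * j - 1))
               *: (free_P (a + b - j) * free_beta * free_P j)))
| AdemSq1 : p = 2%N -> adem_rel (free_beta - free_P 1).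

(* The augmentation, used only to see that the Steenrod algebra is not 0. *)
Definition aug_monom (m : {fmonom steenrod_gen}) : 'F_p :=
  \prod_(g <- m : seq _) (if g is Power 0 then 1 else 0).

Lemma aug_monom_morphism : mmorphism aug_monom.
Proof.
split=> [x y|]; first by rewrite /aug_monom fmM big_cat.
by rewrite /aug_monom fm1 big_nil.
Qed.

HB.instance Definition _ :=
  monalg.isMultiplicative.Build {fmonom steenrod_gen} 'F_p aug_monom
    aug_monom_morphism.

Lemma aug_exists : exists aug : steenrod_free -> 'F_p,
  [/\ {morph aug : x y / x + y}, {morph aug : x y / x * y},
      forall c x, aug (c *: x) = c * aug x & aug 1 = 1]
  /\ (aug free_beta = 0 /\ forall n, aug (free_P n) = (n == 0%N)%:R).
Proof.
exists (mmap idfun aug_monom); split.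
  by split; [exact: mmapD | exact: rmorphM | exact: mmapZ | exact: mmap1].
split=> [|n]; rewrite mmapU /aug_monom fmU big_seq1 ?mulr0 //.
by case: n => [|n]; rewrite /= ?mulr0 ?mulr1.
Qed.

Lemma adem_proper : ~ two_sided_ideal adem_rel 1.
Proof.
have [aug [[augD augM augZ aug1] [augB augP]]] := aug_exists.
have aug0 : aug 0 = 0 by rewrite -[0](scale0r 1) augZ mul0r.
have augN x : aug (- x) = - aug x by rewrite -scaleN1r augZ mulN1r.
have aug_sum m (Q : pred nat) (c : nat -> 'F_p) (F : nat -> steenrod_free) :
    (forall j, Q j -> aug (F j) = 0) ->
    aug (\sum_(0 <= j < m | Q j) c j *: F j) = 0.
  move=> F0; apply: (big_ind (fun x => aug x = 0)) => // [x y|j Qj].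
    by rewrite augD => -> ->; rewrite addr0.
  by rewrite augZ F0 ?mulr0.
suff augI x : two_sided_ideal adem_rel x -> aug x = 0.
  by move=> /augI /eqP; rewrite aug1 oner_eq0.
elim=> [//|u r v {}x rel_r _ augx].
suff -> : aug (u * r * v + x) = aug u * aug r * aug v.
  suff -> : aug r = 0 by rewrite mulr0 mul0r.
  case: rel_r => [|a b ltab|_|a b _ _|_].
  - by rewrite augD augN aug1 augP subrr.
  - have b_gt0 : (0 < b)%N by case: b ltab; rewrite ?muln0.
    rewrite augD augN augM aug_sum.
      by rewrite !augP [b == _]eqn0Ngt b_gt0 mulr0 subr0.
    move=> j leja; have ltjb : (j < b)%N.
      by rewrite -(ltn_pmul2l (m := p)) ?(leq_ltn_trans leja) //; case: p ltab.
    rewrite augM !augP -addnBA 1?ltnW // addn_eq0 subn_eq0.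
    by rewrite leqNgt ltjb andbF mul0r.
  - by rewrite augM augB mul0r.
  - have augBB x1 x2 x3 : aug x1 = 0 -> aug x2 = 0 -> aug x3 = 0 ->
        aug (x1 - (x2 - x3)) = 0.
      by rewrite augD augN augD augN => -> -> ->; rewrite !subr0.
    apply: augBB; [|apply: aug_sum => j _|apply: aug_sum => j _].
    + by rewrite augM [X in X * _]augM augB mulr0 mul0r.
    + by rewrite augM [X in X * _]augM augB !mul0r.
    + by rewrite augM [X in X * _]augM augB mulr0 mul0r.
  - by rewrite augD augN augB augP subrr.
by rewrite augD !augM augx addr0.
Qed.

Definition steenrod := quot_alg adem_proper.

HB.instance Definition _ := GRing.Lalgebra.on steenrod.

Definition stP (n : nat) : steenrod := quot_alg_pi adem_proper (free_P n).

(* The degree n part of the subalgebra generated by the stP i, with stP i in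
   degree i: the span of the monomials in the stP i of total degree n. *)
Definition redpow_deg (n : nat) (x : steenrod) : Prop :=
  exists (m : nat) (c : 'I_m -> 'F_p) (s : 'I_m -> seq nat),
    (forall k, sumn (s k) = n)
    /\ x = \sum_(k < m) c k *: \prod_(i <- s k) stP i.

(* chi_seq n is [:: chi (stP 0); ..; chi (stP n)], where chi is the
   anti-automorphism, computed from its defining recursion. *)
Fixpoint chi_seq (n : nat) : seq steenrod :=
  if n is m.+1 then
    rcons (chi_seq m)
      (- \sum_(1 <= i < m.+2) stP i * nth 0 (chi_seq m) (m.+1 - i))
  else [:: stP 0].

Definition chiP (n : nat) : steenrod := nth 0 (chi_seq n) n.

Lemma size_chi_seq n : size (chi_seq n) = n.+1.
Proof. by elim: n => //= n IH; rewrite size_rcons IH. Qed.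

Lemma nth_chi_seq n k : (k <= n)%N -> nth 0 (chi_seq n) k = chiP k.
Proof.
elim: n => [|n IH]; first by rewrite leqn0 => /eqP->.
rewrite leq_eqVlt => /orP[/eqP->//|ltkn].
by rewrite /= nth_rcons size_chi_seq ltkn IH.
Qed.

Lemma stP0 : stP 0 = 1.
Proof. exact/quot_alg_piP/ideal_gen/AdemP0. Qed.

Lemma chiP0 : chiP 0 = stP 0.
Proof. by []. Qed.

Lemma chiP_sum n : (0 < n)%N -> \sum_(0 <= i < n.+1) stP i * chiP (n - i) = 0.
Proof.
case: n => // n _; rewrite big_nat_recl // subn0 stP0 mul1r {1}/chiP /=.
rewrite nth_rcons size_chi_seq ltnn eqxx big_add1 /= addrC.
apply/eqP; rewrite subr_eq0; apply/eqP; apply: eq_big_nat => i lein.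
by rewrite nth_chi_seq // subSS leq_subr.
Qed.

End SteenrodAlgebra.

(* The base-p digit sum of j; the digits of index k >= j vanish if p > 1. *)
Definition alpha (p j : nat) : nat := (\sum_(k < j) (j %/ p ^ k) %% p)%N.

(* Every j with p j - alpha j < (p - 1) n satisfies j < n, so this bounded
   maximum is the full one: see lmaxP. *)
Definition lmax (p n : nat) : nat :=
  (\max_(j < n | p * j - alpha p j < (p - 1) * n) j)%N.

Lemma alpha_le p j : (1 < p)%N -> (alpha p j <= j)%N.
Proof.
move=> p_gt1; rewrite /alpha.
suff H m : (\sum_(k < m) (j %/ p ^ k) %% p + j %/ p ^ m <= j)%N.
  exact: leq_trans (leq_addr _ _) (H j).
elim: m => [|m IH]; first by rewrite big_ord0 expn0 divn1.
rewrite big_ord_recr /=; apply: leq_trans IH; rewrite -addnA leq_add2l.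
rewrite expnSr divnMA [leqRHS](divn_eq _ p) addnC leq_add2r.
by rewrite leq_pmulr // ltnW.
Qed.

Lemma lmaxP p n : (1 < p)%N -> (0 < n)%N ->
  (p * lmax p n - alpha p (lmax p n) < (p - 1) * n)%N
  /\ forall j, (p * j - alpha p j < (p - 1) * n)%N -> (j <= lmax p n)%N.
Proof.
move=> p_gt1 n_gt0; split.
  have cond0 : (0 < #|[pred j : 'I_n | p * j - alpha p j < (p - 1) * n]|)%N.
    apply/card_gt0P; exists (Ordinal n_gt0).
    by rewrite inE /= muln0 sub0n muln_gt0 subn_gt0 p_gt1.
  rewrite /lmax; have [j Pj] := eq_bigmax_cond (@nat_of_ord n) cond0.
  by rewrite inE in Pj => ->.
move=> j Pj; have ltjn : (j < n)%N.
  rewrite -(ltn_pmul2l (m := p - 1)) ?subn_gt0 //; apply: leq_ltn_trans Pj.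
  by rewrite mulnBl mul1n leq_sub2l // alpha_le.
exact: (@leq_bigmax_cond _ (fun j : 'I_n => (p * j - alpha p j < (p - 1) * n)%N)
  (@nat_of_ord n) (Ordinal ltjn)).
Qed.

(* Main.v *)
Require Import Defs.
From HB Require Import structures.
From mathcomp Require Import all_boot all_order all_algebra.
From mathcomp Require Import zify ring.
From mathcomp.multinomials Require Import monalg.
Import GRing.Theory.
Local Open Scope ring_scope.
Set Implicit Arguments.
Unset Strict Implicit.
Unset Printing Implicit Defensive.

(** The elements P^i chi(P^(n-i)) are separated by matrix coefficients of
    explicit modules over the Steenrod algebra.

    Let the total power P(s) = sum_n s^n P^n act on a space with basis e_0,
    e_1, ..., e_N by e_k |-> e_k + s^(p^k) e_(k+1), as it acts on the classes
    x^(p^k) for x a polynomial generator with P^1 x = x^p, and let it act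
    diagonally on the r-th tensor power.  The total conjugate chi P(1) is the
    inverse of P(1), so it acts by e_l |-> sum_(m >= l) (-1)^(m-l) e_m on each
    factor.  If all w_i are positive, the coefficient of
    e_(w_1) (x) ... (x) e_(w_r) in P(s) chi P(1) (e_0 (x) ... (x) e_0) is, up
    to sign, prod_i (1 - s^(p^(w_i - 1))) = (1 - s)^A, where
    A = sum_i p^(w_i - 1).  In the degree n of that basis vector, this
    coefficient therefore sends P^i chi(P^(n-i)) to 'C(A, i) up to sign
    (power_conj_top).  As the matrix 'C(A, i) is unitriangular, independence
    follows once every A with l(n) < A <= n arises in this way.

    Now A arises when it is a sum of r powers of p with p A - r = (p - 1) n.
    The base-p digits write A with alpha(A) powers, and splitting p^(k+1) into
    p copies of p^k adds p - 1 to the number of powers, until there are A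
    of them.  Hence A arises as soon as A <= n and (p - 1) n <= p A - alpha(A)
    (powers_of_weight), and the second inequality is what A > l(n) means.

    It remains to see that the Adem relations hold in these modules.  On each
    tensor factor P(x) P(y) depends only on x + y and x^p y
    (total_entry_comp).  With q = (1 - t)^(p-1) this gives the identity of
    Bullett and Macdonald, P(t q) P(1) = P(q) P(t^p), and its coefficient at
    (t q)^a is the Adem relation for P^a P^b (adem_coef, power_power_adem).
    The Bockstein can be sent to 0 when p is odd, because every term of the
    relations that involve it contains it, and to P^1 when p = 2
    (steenrod_rep). *)

(** * Extraction of the Adem coefficients *)

Lemma pchar_polyFp p : prime p -> p \in [pchar {poly 'F_p}].
Proof. by move=> p_pr; rewrite pchar_poly pchar_Fp. Qed.

Lemma pnat_pcharFp p (p_pr : prime p) M : [pchar {poly 'F_p}].-nat (p ^ M)%N.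
Proof.
by rewrite (eq_pnat _ (pcharf_eq (pchar_polyFp p_pr))) pnatX pnat_id.
Qed.

Lemma exprD_Fp p (p_pr : prime p) M (x y : {poly 'F_p}) :
  (x + y) ^+ (p ^ M) = x ^+ (p ^ M) + y ^+ (p ^ M).
Proof. exact/exprDn_pchar/pnat_pcharFp. Qed.

Lemma exprB_Fp p (p_pr : prime p) M (x y : {poly 'F_p}) :
  (x - y) ^+ (p ^ M) = x ^+ (p ^ M) - y ^+ (p ^ M).
Proof. by rewrite -[in RHS](subrK y x) (exprD_Fp p_pr M (x - y)) addrK. Qed.

Lemma signr_Fp p (p_pr : prime p) j : (-1) ^+ (p * j) = (-1) ^+ j :> 'F_p.
Proof.
rewrite exprM; congr (_ ^+ _); apply: polyC_inj.
rewrite polyC_exp polyCN polyC1.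
have := exprB_Fp p_pr 1 0 1; rewrite expn1 expr0n expr1n !sub0r => ->.
by case: (p) p_pr => // q _; rewrite sub0r.
Qed.

Lemma coef_1subX_exp (R : comNzRingType) e k :
  ((1 - 'X) ^+ e : {poly R})`_k = (-1) ^+ k *+ 'C(e, k).
Proof.
rewrite exprBn coef_sum.
under eq_bigr => i _.
  rewrite expr1n mulr1 coefMn -[(-1) ^+ i]/((- (1%:P)) ^+ i) -polyCN -polyC_exp.
  rewrite coefCM coefXn; over.
have [le_ke|lt_ek] := leqP k e.
  rewrite (bigD1 (Ordinal (le_ke : k < e.+1)%N)) //= eqxx mulr1 big1 ?addr0 //.
  by move=> i; rewrite -val_eqE /= eq_sym => /negPf->; rewrite mulr0 mul0rn.
rewrite bin_small // mulr0n big1 // => i _; rewrite gtn_eqF ?mulr0 ?mul0rn //.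
exact: leq_ltn_trans (leq_ord i) lt_ek.
Qed.

(** With s = t (1 - t)^(p-1), the differential s^(-m-1) ds has no residue at 0
    when m > 0, and up to sign 'C(N, m) is that residue.  The proof counts
    factors p in (N + 1) 'C(N, m) = (N + 1 - m) 'C(N + 1, m): as
    N + 1 - m = p^M - p m, the right side has more of them than m, while
    N + 1 = p^M - (p - 1) m has as many as m. *)
Lemma residue_bin_dvd p m M N : prime p -> (0 < m)%N -> (m < p ^ M)%N ->
  (N + (p - 1) * m + 1 = p ^ M)%N -> (p %| 'C(N, m))%N.
Proof.
move=> p_pr m_gt0 m_lt NE; set v := logn p m.
have p_gt1 := prime_gt1 p_pr.
have pvm : (p ^ v %| m)%N by apply: pfactor_dvdnn.
have ltvM : (v < M)%N.
  rewrite -(ltn_exp2l _ _ p_gt1); apply: leq_ltn_trans m_lt.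
  exact: dvdn_leq.
have dvdNC : (p ^ v.+1 %| N.+1 * 'C(N, m))%N.
  rewrite (mul_bin_down N.+1 m) dvdn_mulr //.
  have -> : (N.+1 - m = p ^ M - p * m)%N.
    by rewrite -NE; case: (p) p_gt1 => // q _; rewrite subn1 /=; nia.
  by rewrite dvdn_sub ?dvdn_exp2l // expnS dvdn_pmul2l ?prime_gt0.
case: (boolP (p %| _)%N) => // pNC; move: dvdNC.
rewrite Gauss_dvdl ?coprimeXl ?prime_coprime // => dvdN.
have : (p ^ v.+1 %| N.+1 + (p - 1) * m)%N.
  by rewrite addSn -[(N + _).+1]addn1 NE dvdn_exp2l.
rewrite dvdn_addr // Gauss_dvdr ?pfactor_dvdn ?ltnn //.
by rewrite coprimeXl // subn1 coprimenP ?prime_gt0.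
Qed.

(** For s = 'X (1 - 'X)^(p-1), the coefficient of s^a in a series f is the
    residue of f s^(-a-1) ds.  As ds = (1 - 'X)^(p-2) d'X in characteristic p,
    this is the coefficient of 'X^a in f (1 - 'X)^(-(p-1)a - 1). *)
Lemma adem_coef p (p_pr : prime p) a b (c d : nat -> 'F_p) : (a < p * b)%N ->
  \sum_(i < (a + b).+1) c i *: ('X * (1 - 'X) ^+ (p - 1)) ^+ i =
    \sum_(j < (a + b).+1)
       d j *: (((1 - 'X) ^+ (p - 1)) ^+ (a + b - j) * ('X ^+ p) ^+ j)
    :> {poly 'F_p} ->
  c a = \sum_(0 <= j < a.+1 | (p * j <= a)%N)
          ((-1) ^+ (a + j) *+ 'C((p - 1) * (b - j) - 1, a - p * j)) * d j.
Proof.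
move=> lt_apb eqS; have p_gt1 := prime_gt1 p_pr.
(* The factor (1 - 'X)^(p^M) is 1 modulo 'X^(a+1), and it makes the exponent
   -(p-1)a - 1 nonnegative. *)
set M := (p * a).+1; set K := (p ^ M - 1 - (p - 1) * a)%N.
have ltM : (p * a + 1 < p ^ M)%N.
  by rewrite /M addn1; apply: ltn_expl.
have KE : (K + (p - 1) * a + 1 = p ^ M)%N.
  by move: ltM; rewrite /K; case: (p) p_gt1 => // q _; nia.
have {eqS} /(congr1 (fun f : {poly 'F_p} => (f * (1 - 'X) ^+ K)`_a)) := eqS.
rewrite !mulr_suml !coef_sum.
rewrite (bigD1 (Ordinal (leq_addr b a : a < (a + b).+1)%N)) //=.
rewrite -scalerAl coefZ exprMn -exprM -mulrA -exprD coefXnM ltnn subnn.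
rewrite coef_1subX_exp bin0 expr0 mulr1 big1 ?addr0; last first.
  move=> i; rewrite -val_eqE /= => neq_ia.
  rewrite -scalerAl coefZ exprMn -exprM -mulrA -exprD coefXnM.
  case: ltnP => [|le_ia]; first by rewrite mulr0.
  rewrite coef_1subX_exp.
  have /dvdnP [x ->] : (p %| 'C((p - 1) * i + K, a - i))%N.
    apply: (@residue_bin_dvd p _ M) => //; [lia| |].
      by apply: leq_ltn_trans ltM; nia.
    by rewrite -KE; nia.
  by rewrite mulrnA -mulr_natr (pcharf0 (pchar_Fp p_pr)) !mulr0.
move=> ->.
have -> : \sum_(i < (a + b).+1) (d i *: (((1 - 'X) ^+ (p - 1)) ^+ (a + b - i)
    * ('X ^+ p) ^+ i) * (1 - 'X) ^+ K)`_a =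
  \sum_(i < (a + b).+1 | (p * i <= a)%N)
    ((-1) ^+ (a + i) *+ 'C((p - 1) * (b - i) - 1, a - p * i)) * d i.
  rewrite [RHS]big_mkcond; apply: eq_bigr => i _ /=.
  rewrite -scalerAl coefZ mulrAC -!exprM -exprD coefMXn.
  case: leqP => [le_pia|_]; last by rewrite mulr0.
  have lt_ib : (i < b)%N by rewrite -(ltn_pmul2l (ltnW p_gt1)); lia.
  have -> : ((p - 1) * (a + b - i) + K = p ^ M + ((p - 1) * (b - i) - 1))%N.
    have : (0 < (p - 1) * (b - i))%N by rewrite muln_gt0 !subn_gt0 p_gt1.
    have -> : ((p - 1) * (a + b - i) = (p - 1) * a + (p - 1) * (b - i))%N.
      by rewrite -mulnDr addnBA // ltnW.
    lia.
  rewrite exprD exprB_Fp // mulrBl expr1n mul1r coefB coefXnM.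
  rewrite ifT ?subr0; last first.
    by apply: leq_ltn_trans ltM; nia.
  rewrite coef_1subX_exp mulrC; congr (_ *+ _ * _).
  (* The exponents p * i and i have the same parity unless p = 2, when
     -1 = 1. *)
  rewrite exprD -(signr_Fp p_pr i) -exprD.
  have -> : (a + p * i = a - p * i + 2 * (p * i))%N by lia.
  by rewrite exprD exprM sqrrN !expr1n mulr1.
rewrite -(big_mkord (fun i => (p * i <= a)%N) (fun i =>
  ((-1) ^+ (a + i) *+ 'C((p - 1) * (b - i) - 1, a - p * i)) * d i)).
rewrite (@big_cat_nat _ _ _ a.+1) //= ?ltnS ?leq_addr //.
rewrite [X in _ + X]big_nat_cond [X in _ + X]big_pred0 ?addr0 // => i.
by apply/negbTE/negP; move: p_gt1; nia.
Qed.

(** * Representations of the Steenrod algebra *)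

(** Scaling by a prime field is iterated addition, so it commutes with every
    additive map, and with multiplication on either side. *)
Lemma scale_Fp p (V : lmodType 'F_p) (c : 'F_p) (v : V) : c *: v = v *+ c.
Proof. by rewrite -[in LHS](natr_Zp c) scaler_nat. Qed.

Section WordProduct.

Variables (B : nzRingType) (phi : steenrod_gen -> B).

Definition word_prod (m : {fmonom steenrod_gen}) : B :=
  \prod_(g <- m : seq _) phi g.

Lemma word_prod_morphism : mmorphism word_prod.
Proof.
by split=> [x y|]; rewrite /word_prod ?fmM ?big_cat // fm1 big_nil.
Qed.

HB.instance Definition _ :=
  monalg.isMultiplicative.Build {fmonom steenrod_gen} B word_prod
    word_prod_morphism.

End WordProduct.

(** The relations between reduced powers alone suffice to define a
    representation: the Bockstein acts by 0 if p is odd and by T 1 if p = 2. *)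
Lemma steenrod_rep p (p_pr : prime p) (B : algType 'F_p) (T : nat -> B) :
  T 0%N = 1 ->
  (forall a b, (a < p * b)%N -> T a * T b =
     \sum_(0 <= j < a.+1 | (p * j <= a)%N)
        ((-1) ^+ (a + j) *+ 'C((p - 1) * (b - j) - 1, a - p * j))
          *: (T (a + b - j)%N * T j)) ->
  exists F : {rmorphism steenrod p -> B}, forall n, F (stP p n) = T n.
Proof.
move=> T0 Tadem.
pose phi g := if g is Power n then T n else if p == 2%N then T 1%N else 0.
pose f0 : steenrod_free p -> B := mmap (in_alg B) (word_prod phi).
have [f01 f0M] : f0 1 = 1 /\ {morph f0 : x y / x * y}.
  have [] := @commr_mmap_is_multiplicative _ _ _ (in_alg B) (word_prod phi).
    by move=> g m m'; apply: comm_alg.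
  by [].
have f0B : {morph f0 : x y / x - y} by exact: mmapB.
have f0_sum I (s : seq I) (Q : pred I) (G : I -> steenrod_free p) :
    f0 (\sum_(i <- s | Q i) G i) = \sum_(i <- s | Q i) f0 (G i).
  by apply: big_morph => [x y|]; [exact: mmapD | exact: mmap0].
have f0Z c : {morph f0 : x / c *: x}.
  by move=> x; rewrite !scale_Fp [LHS]mmapMn.
have f0g g : f0 << fmu g >> = phi g.
  by rewrite /f0 mmapU /word_prod fmU big_seq1 /= scale1r mul1r.
have f0P n : f0 (free_P p n) = T n by rewrite /free_P f0g.
have f0I x : two_sided_ideal (@adem_rel p) x -> f0 x = 0.
  elim=> [|u r v {}x rel_r _ f0x]; first exact: mmap0.
  have f0D : {morph f0 : y z / y + z} by exact: mmapD.
  suff fr0 : f0 r = 0 by rewrite f0D !f0M f0x fr0 mulr0 mul0r add0r.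
  have beta0 : odd p -> f0 (free_beta p) = 0.
    move=> p_odd; rewrite /free_beta f0g /=.
    by case: eqP => [/(congr1 odd)|//]; rewrite p_odd.
  case: rel_r => [|a b lt_ab|p_odd|a b p_odd _|p2].
  - by rewrite f0B f0P f01 T0 subrr.
  - rewrite f0B f0M !f0P Tadem // f0_sum; apply/eqP; rewrite subr_eq0.
    by apply/eqP/eq_bigr => j _; rewrite f0Z f0M !f0P.
  - by rewrite f0M beta0 // mul0r.
  - have f0uBv y z : f0 (y * free_beta p * z) = 0.
      by rewrite f0M (f0M y) beta0 // mulr0 mul0r.
    have f0Bv y z : f0 (free_beta p * y * z) = 0.
      by rewrite f0M (f0M _ y) beta0 // !mul0r.
    have f0BB y1 y2 y3 :
        f0 y1 = 0 -> f0 y2 = 0 -> f0 y3 = 0 -> f0 (y1 - (y2 - y3)) = 0.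
      by move=> y10 y20 y30; rewrite f0B f0B y10 y20 y30 !subr0.
    apply: f0BB; first exact: f0uBv.
      by rewrite f0_sum big1 // => j _; rewrite f0Z f0Bv scaler0.
    by rewrite f0_sum big1 // => j _; rewrite f0Z f0uBv scaler0.
  - by rewrite f0B f0P /free_beta f0g /phi (introT eqP p2) subrr.
pose F (x : steenrod p) : B := f0 (repr x).
have FE x : F (quot_alg_pi (@adem_proper p) x) = f0 x.
  apply/esym/eqP; rewrite -subr_eq0 -f0B; apply/eqP/f0I.
  exact: (quot_alg_repr (@adem_proper p)).
have F_zmod : zmod_morphism F.
  elim/quot_alg_piW=> x; elim/quot_alg_piW=> y.
  by rewrite -raddfB !FE f0B.
have F_monoid : monoid_morphism F.
  split; first by rewrite -(rmorph1 (quot_alg_pi (@adem_proper p))) FE f01.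
  elim/quot_alg_piW=> x; elim/quot_alg_piW=> y.
  by rewrite -rmorphM !FE f0M.
pose FA := GRing.isZmodMorphism.Build _ _ F F_zmod.
pose FM := GRing.isMonoidMorphism.Build _ _ F F_monoid.
pose FR : {rmorphism steenrod p -> B} := HB.pack F FA FM.
by exists FR => n; rewrite /= FE f0P.
Qed.

(** * The tensor powers of the module spanned by the x^(p^k) *)

Section TensorPower.

Variables (p : nat) (p_pr : prime p) (r N : nat).

Local Notation K := 'F_p.
Local Notation R := {poly 'F_p}.
Local Notation I := {ffun 'I_r -> 'I_N.+1}.

Implicit Types (u v w : I) (x y : R).

(** (p^k - 1) / (p - 1), the degree of e_k when e_0 has degree 0 and P^n raises
    degrees by n. *)
Definition wt (k : nat) : nat := (\sum_(i < k) p ^ i)%N.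

Definition deg (v : I) : nat := (\sum_i wt (v i))%N.

(** Whether e_k occurs in P(s) e_l. *)
Definition step1 (k l : nat) : bool := (k == l) || (k == l.+1).

Definition step (w v : I) : bool := [forall i, step1 (w i) (v i)].

Definition below (v w : I) : bool := [forall i, (v i <= w i)%N].

Lemma wtS k : wt k.+1 = (wt k + p ^ k)%N.
Proof. by rewrite /wt big_ord_recr. Qed.

Lemma wt_le k l : (k <= l)%N -> (wt k <= wt l)%N.
Proof.
move=> /subnK <-; elim: (l - k)%N => // d IH.
by rewrite addSn wtS; apply: leq_trans IH (leq_addr _ _).
Qed.

Lemma deg_le v w : below v w -> (deg v <= deg w)%N.
Proof. by move=> /forallP le_vw; apply: leq_sum => i _; exact: wt_le. Qed.

Lemma step_below w v : step w v -> below v w.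
Proof.
move=> /forallP st; apply/forallP => i.
by case/orP: (st i) => /eqP ->.
Qed.

(** The coefficient of e_k in P(x) e_l: rows are targets and columns sources,
    so that products of matrices are composites of operations. *)
Definition total_entry (x : R) (k l : nat) : R :=
  (step1 k l)%:R * x ^+ (wt k - wt l).

Lemma prod_total_entry x w v :
  \prod_i total_entry x (w i) (v i) = (step w v)%:R * x ^+ (deg w - deg v).
Proof.
have [st|/forallPn [i /negPf nst]] := boolP (step w v); last first.
  by rewrite mul0r (bigD1 i) //= /total_entry nst !mul0r.
have le_vw i : (v i <= w i)%N by have /forallP := step_below st.
rewrite mul1r /deg -sumnB => [|i _]; last exact: wt_le.
rewrite expr_sum; apply: eq_bigr => i _.
by rewrite /total_entry (forallP st i) mul1r.
Qed.

Lemma sum_step_prod x (h : 'I_r -> nat -> R) w :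
  \sum_u (step w u)%:R * x ^+ (deg w - deg u) * \prod_i h i (u i) =
  \prod_i \sum_(m < N.+1) total_entry x (w i) m * h i m.
Proof.
rewrite bigA_distr_bigA; apply: eq_bigr => u _.
by rewrite -prod_total_entry -big_split.
Qed.

Lemma sum_total_entry x (h : nat -> R) k : (k <= N)%N ->
  \sum_(m < N.+1) total_entry x k m * h m =
  h k + (if k is k'.+1 then x ^+ (p ^ k') * h k' else 0).
Proof.
move=> le_kN; rewrite (bigD1 (Ordinal (le_kN : k < N.+1)%N)) //=.
rewrite /total_entry /step1 eqxx subnn mulr1 mul1r; congr (_ + _).
case: k le_kN => [|k] le_kN.
  rewrite big1 // => m; rewrite -val_eqE /= => m0.
  by rewrite eq_sym (negPf m0) !mul0r.
rewrite (bigD1 (Ordinal (ltnW le_kN : k < N.+1)%N)) /=; last first.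
  by rewrite -val_eqE /= ltn_eqF.
rewrite eqxx orbT mul1r wtS addKn big1 ?addr0 // => m.
rewrite -!val_eqE /= => /andP [m1 m2].
by rewrite eq_sym (negPf m1) eqSS eq_sym (negPf m2) !mul0r.
Qed.

(** The coefficient of e_w in P^n e_v on the tensor power: P(x) has the entry
    x^(deg w - deg v) there by prod_total_entry. *)
Definition power_entry (n : nat) (w v : I) : K :=
  (step w v && (deg w == deg v + n)%N)%:R.

(** The coefficient of e_w in chi(P^n) e_v: the inverse of
    e_k |-> e_k + e_(k+1) is e_l |-> sum_(m >= l) (-1)^(m-l) e_m on each factor,
    and the grading isolates chi(P^n). *)
Definition conj_entry (n : nat) (w v : I) : K :=
  (below v w && (deg w == deg v + n)%N)%:R * \prod_i (-1) ^+ (w i + v i).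

(** In a product of two homogeneous families, the intermediate basis vector u
    determines the index a = deg w - deg u.  Summing over a therefore removes
    the degree conditions and leaves a sum that factors over the tensor
    product; the weights x and z keep track of the two degrees. *)
Lemma sum_power_gen (w v : I) (n : nat) (x : R) (z : nat -> R)
    (G : nat -> I -> K) (g : I -> K) :
  deg w = (deg v + n)%N ->
  (forall b u, G b u = (below v u && (deg u == deg v + b)%N)%:R * g u) ->
  \sum_(a < n.+1) (\sum_u power_entry a w u * G (n - a)%N u)
     *: (x ^+ a * z (n - a)%N) =
  \sum_u (step w u)%:R * x ^+ (deg w - deg u)
     * (((below v u)%:R * g u) *: z (deg u - deg v)%N).
Proof.
move=> degw GE; under eq_bigr => a _ do rewrite scaler_suml.
rewrite exchange_big; apply: eq_bigr => u _ /=; rewrite /power_entry.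
have [st|_] /= := boolP (step w u); last first.
  by rewrite !mul0r big1 // => a _; rewrite mul0r scale0r.
have [vu|nvu] := boolP (below v u); last first.
  rewrite mul0r scale0r mulr0 big1 // => a _.
  by rewrite GE (negPf nvu) mul0r mulr0 scale0r.
have le_uw := deg_le (step_below st); have le_vu := deg_le vu.
have lt_a : (deg w - deg u < n.+1)%N by lia.
rewrite (bigD1 (Ordinal lt_a)) //= big1 ?addr0 => [|a]; last first.
  rewrite -val_eqE /= => neq_a; have -> : (deg w == deg u + a)%N = false by lia.
  by rewrite mul0r scale0r.
have -> : (deg w == deg u + (deg w - deg u))%N by lia.
have -> : (n - (deg w - deg u) = deg u - deg v)%N by lia.
rewrite GE vu; have -> : (deg u == deg v + (deg u - deg v))%N by lia.
by rewrite !mul1r scalerAr.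
Qed.

Lemma power_power_gen x y w v n : deg w = (deg v + n)%N ->
  \sum_(a < n.+1) (\sum_u power_entry a w u * power_entry (n - a)%N u v)
     *: (x ^+ a * y ^+ (n - a)) =
  \prod_i \sum_(m < N.+1) total_entry x (w i) m * total_entry y m (v i).
Proof.
move=> degw; rewrite (@sum_power_gen w v n x (fun b => y ^+ b)
  (fun b u => power_entry b u v) (fun u => (step u v)%:R)) //; last first.
  move=> b u; rewrite /power_entry.
  have [st|_] := boolP (step u v); last by rewrite mulr0.
  by rewrite (step_below st) mulr1.
rewrite -(sum_step_prod x (fun i m => total_entry y m (v i))).
apply: eq_bigr => u _; rewrite prod_total_entry; congr (_ * _).
have [st|_] := boolP (step u v); last by rewrite mulr0 scale0r mul0r.
by rewrite (step_below st) mulr1 scale1r mul1r.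
Qed.

(** P(x) P(y) sends e_l to
    e_l + (x + y)^(p^l) e_(l+1) + (x^p y)^(p^l) e_(l+2). *)
Lemma total_entry_comp x y x' y' k l : (k <= N)%N ->
  x + y = x' + y' -> x ^+ p * y = x' ^+ p * y' ->
  \sum_(m < N.+1) total_entry x k m * total_entry y m l =
  \sum_(m < N.+1) total_entry x' k m * total_entry y' m l.
Proof.
move=> le_kN eqD eqM.
rewrite (sum_total_entry x (fun m => total_entry y m l)) //.
rewrite (sum_total_entry x' (fun m => total_entry y' m l)) //.
rewrite /total_entry /step1; case: k {le_kN} => [|k].
  by rewrite /wt big_ord0 sub0n !expr0.
have [<-|neq_kl] := eqVneq k.+1 l.
  by rewrite subnn !expr0 /= ltn_eqF // ltn_eqF ?mul0r ?mulr0 // ltnW.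
rewrite eqSS /=; have [<-|neq_kl'] /= := eqVneq k l.
  by rewrite subnn wtS addKn !mulr1 !mul1r -!exprD_Fp // ![_ + x]addrC
    ![_ + x']addrC eqD.
case: eqP => [->|]; last by rewrite !mul0r !mulr0.
by rewrite !mul0r !add0r !mul1r wtS addKn expnS !exprM -!exprMn eqM.
Qed.

(** On each factor P(x) composed with the inverse of P(1) sends e_l to e_l plus
    the sum over k > l of (-1)^(k-l) (1 - x^(p^(k-1))) e_k: in degree k, the
    terms e_k and x^(p^(k-1)) e_k come from e_k and e_(k-1) in the inverse. *)
Lemma power_conj_gen x w v n : deg w = (deg v + n)%N ->
  \sum_(a < n.+1) (\sum_u power_entry a w u * conj_entry (n - a)%N u v)
     *: x ^+ a =
  \prod_i ((w i == v i)%:R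
    + (v i < w i)%:R * (-1) ^+ (w i + v i) * (1 - x ^+ (p ^ (w i).-1))).
Proof.
move=> degw.
transitivity (\sum_(a < n.+1)
  (\sum_u power_entry a w u * conj_entry (n - a)%N u v) *: (x ^+ a * 1)).
  by apply: eq_bigr => a _; rewrite mulr1.
rewrite (@sum_power_gen w v n x (fun b => 1) (fun b u => conj_entry b u v)
  (fun u => \prod_i (-1) ^+ (u i + v i))) //.
pose h i (m : nat) : R := (v i <= m)%N%:R * (-1) ^+ (m + v i).
transitivity (\sum_u (step w u)%:R * x ^+ (deg w - deg u) * \prod_i h i (u i)).
  apply: eq_bigr => u _; congr (_ * _).
  rewrite /h big_split /=.
  have -> : \prod_i (v i <= u i)%N%:R = (below v u)%:R :> R.
    have [/forallP vu|/forallPn [i /negPf nvu]] := boolP (below v u).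
      by rewrite big1 // => i _; rewrite vu.
    by rewrite (bigD1 i) //= nvu mul0r.
  have [vu|_] := boolP (below v u); last by rewrite !mul0r scale0r.
  rewrite !mul1r -mul_polyC mulr1 rmorph_prod /=; apply: eq_bigr => i _.
  by rewrite rmorphXn /= polyCN.
rewrite sum_step_prod; apply: eq_bigr => i _.
rewrite sum_total_entry ?leq_ord // /h -val_eqE /=.
case: (nat_of_ord (w i)) => [|k].
  by case: (nat_of_ord (v i)) => [|l]; rewrite /= !mul0r ?mul1r !addr0.
rewrite /= addSn !exprS; have [lt_vk|lt_kv|->] := ltngtP (v i) k.+1.
- move: (lt_vk); rewrite ltnS => -> /=; rewrite !mul1r add0r.
  by set e := _ ^+ (k + _); ring.
- by rewrite leqNgt ltnW ?mul0r ?mulr0 ?addr0.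
- by rewrite ltnn !mul0r mulr0 !addr0 mul1r -exprS -addSn addnn -mul2n exprM
    sqrrN !expr1n.
Qed.

(** The Adem relations, entry by entry: the Bullett-Macdonald identity
    P(t q) P(1) = P(q) P(t^p) is compared at the coefficient of (t q)^a. *)
Lemma power_power_adem w v a b : (a < p * b)%N ->
  \sum_u power_entry a w u * power_entry b u v =
  \sum_(0 <= j < a.+1 | (p * j <= a)%N)
    ((-1) ^+ (a + j) *+ 'C((p - 1) * (b - j) - 1, a - p * j))
      * \sum_u power_entry (a + b - j)%N w u * power_entry j u v.
Proof.
move=> lt_apb.
have [degw|degw] := eqVneq (deg w) (deg v + (a + b))%N; last first.
  have prod0 a' b' : (a' + b' = a + b)%N ->
      \sum_u power_entry a' w u * power_entry b' u v = 0.
    move=> eq_ab; apply: big1 => u _; rewrite /power_entry.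
    case: (_ =P _) => [dw|]; rewrite ?andbF ?mul0r //.
    case: (_ =P _) => [du|]; rewrite ?andbF ?mulr0 //.
    by case/eqP: degw; rewrite dw du -addnA [(b' + _)%N]addnC eq_ab.
  rewrite prod0 // big_nat_cond big1 // => j /andP [/andP [_ le_ja] _].
  by rewrite prod0 ?mulr0 // subnK // (leq_trans _ (leq_addr _ _)).
pose c i : K := \sum_u power_entry i w u * power_entry (a + b - i)%N u v.
have -> : \sum_u power_entry a w u * power_entry b u v = c a.
  by rewrite /c addKn.
pose t : R := 'X; pose q : R := (1 - 'X) ^+ (p - 1).
have p_gt0 := prime_gt0 p_pr.
have qE : q * (1 - t) = 1 - t ^+ p.
  rewrite /q -exprSr subn1 prednK //.
  by have := exprB_Fp p_pr 1 1 t; rewrite expn1 expr1n.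
have sumE : t * q + 1 = q + t ^+ p.
  transitivity (q + (1 - q * (1 - t))); [by ring|by rewrite qE; ring].
pose d j : K := \sum_u power_entry (a + b - j)%N w u * power_entry j u v.
apply: (@adem_coef p p_pr a b c d lt_apb).
transitivity (\prod_i \sum_(m < N.+1)
    total_entry (t * q) (w i) m * total_entry 1 m (v i)).
  rewrite -(power_power_gen _ _ degw); apply: eq_bigr => i _.
  by rewrite expr1n mulr1.
transitivity (\prod_i \sum_(m < N.+1)
    total_entry q (w i) m * total_entry (t ^+ p) m (v i)).
  apply: eq_bigr => i _; apply: total_entry_comp => //; first exact: leq_ord.
  by rewrite mulr1 exprMn mulrC.
rewrite -(power_power_gen _ _ degw) (reindex_inj rev_ord_inj) /=.
apply: eq_bigr => j _; rewrite subSS /d.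
by have -> : (a + b - (a + b - j) = j)%N by rewrite subKn ?leq_ord.
Qed.

(** At x = 1 the product in power_conj_gen vanishes unless w = v, which is the
    recursion that defines chi. *)
Lemma power_conj_sum w v n : (0 < n)%N ->
  \sum_(a < n.+1) \sum_u power_entry a w u * conj_entry (n - a)%N u v = 0.
Proof.
move=> n_gt0; have [degw|degw] := eqVneq (deg w) (deg v + n)%N; last first.
  apply: big1 => a _; apply: big1 => u _; rewrite /power_entry /conj_entry.
  case: (_ =P _) => [dw|]; rewrite ?andbF ?mul0r //.
  case: (_ =P _) => [du|]; rewrite ?andbF ?mul0r ?mulr0 //.
  by case/eqP: degw; rewrite dw du -addnA subnK ?leq_ord.
transitivity ((\sum_(a < n.+1)
    (\sum_u power_entry a w u * conj_entry (n - a)%N u v) *: 1 ^+ a : R)`_0).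
  rewrite coef_sum; apply: eq_bigr => a _.
  by rewrite expr1n coefZ coef1 mulr1.
rewrite power_conj_gen //.
have [i neq_wv] : exists i, w i != v i.
  apply/existsP; apply: contraTT n_gt0 => /existsPn eq_wv.
  have: w = v by apply/ffunP => i; apply/eqP; rewrite -[_ == _]negbK eq_wv.
  by move=> wv; move: degw; rewrite wv -{1}[deg v]addn0 => /addnI <-.
by rewrite (bigD1 i) //= (negPf neq_wv) expr1n subrr mulr0 addr0 mul0r coef0.
Qed.

(** When every factor is raised, the product in power_conj_gen is
    prod_i (1 - 'X^(p^(w_i - 1))) = (1 - 'X)^A up to sign, by Frobenius. *)
Lemma power_conj_top w v n : deg w = (deg v + n)%N ->
  (forall i, v i < w i)%N ->
  forall a, (a <= n)%N ->
  \sum_u power_entry a w u * conj_entry (n - a)%N u v =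
  (-1) ^+ (\sum_i (w i + v i) + a) *+ 'C(\sum_i p ^ (w i).-1, a).
Proof.
move=> degw lt_vw a le_an.
have := power_conj_gen 'X degw => /(congr1 (fun f : R => f`_a)).
rewrite -(poly_def n.+1 (fun a => \sum_u power_entry a w u
  * conj_entry (n - a)%N u v)) coef_poly ltnS le_an => ->.
transitivity ((\prod_i ((-1) ^+ (w i + v i))%:P
    * \prod_i (1 - 'X) ^+ (p ^ (w i).-1) : R)`_a).
  rewrite -big_split /=; congr ((_ : R)`_a); apply: eq_bigr => i _ .
  rewrite lt_vw -val_eqE /= gtn_eqF // add0r mul1r.
  by rewrite exprB_Fp // expr1n rmorphXn /= polyCN.
rewrite -rmorph_prod /= coefCM -!expr_sum coef_1subX_exp.
by rewrite exprD mulrnAr.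
Qed.

Lemma deg_inj v w : below v w -> deg w = deg v -> w = v.
Proof.
move=> /forallP vw eq_deg; apply/ffunP => i; apply/val_inj/eqP => /=.
rewrite eqn_leq vw andbT leqNgt; apply/negP => lt_i.
have : (deg v < deg w)%N.
  rewrite /deg (bigD1 i) //= [ltnRHS](bigD1 i) //= -addSn; apply: leq_add.
    apply: leq_trans (wt_le lt_i).
    by rewrite wtS -addn1 leq_add2l expn_gt0 prime_gt0.
  by apply: leq_sum => j _; apply: wt_le.
by rewrite eq_deg ltnn.
Qed.

Lemma power_entry0 w v : power_entry 0 w v = (w == v)%:R.
Proof.
rewrite /power_entry addn0; have [->|neq_wv] := eqVneq w v.
  by rewrite eqxx andbT /step (introT forallP) // => i; rewrite /step1 eqxx.
case: andP => // -[/step_below vw /eqP] /(deg_inj vw) eq_wv.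
by rewrite eq_wv eqxx in neq_wv.
Qed.

Lemma conj_entry0 w v : conj_entry 0 w v = (w == v)%:R.
Proof.
rewrite /conj_entry addn0; have [->|neq_wv] := eqVneq w v.
  rewrite eqxx andbT /below (introT forallP) // mul1r big1 // => i _.
  by rewrite addnn -mul2n exprM sqrrN !expr1n.
case: andP => [[vw /eqP]|]; last by rewrite mul0r.
by move=> /(deg_inj vw) eq_wv; rewrite eq_wv eqxx in neq_wv.
Qed.

Lemma steenrod_matrix_rep :
  exists d (f : 'I_d.+1 -> I) (F : {rmorphism steenrod p -> 'M[K]_d.+1}),
    bijective f
    /\ forall n k l, F (stP p n) k l = power_entry n (f k) (f l).
Proof.
have card_I : #|{: I}|.-1.+1 = #|{: I}|.
  by rewrite prednK //; apply/card_gt0P; exists [ffun=> ord0].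
pose f k : I := enum_val (cast_ord card_I k).
have f_bij : bijective f.
  by apply: bij_comp; [exact: enum_val_bij | exists (cast_ord (esym card_I));
    [exact: cast_ordK | exact: cast_ordKV]].
pose T n : 'M[K]_(#|{: I}|.-1.+1) := \matrix_(k, l) power_entry n (f k) (f l).
have TM a b k l :
    (T a * T b) k l = \sum_u power_entry a (f k) u * power_entry b u (f l).
  rewrite -mulmxE mxE [RHS](reindex f) /=; last exact: onW_bij.
  by apply: eq_bigr => m _; rewrite !mxE.
have [||F FE] := steenrod_rep p_pr (T := T).
- by apply/matrixP => k l; rewrite !mxE power_entry0 (bij_eq f_bij).
- move=> a b lt_apb; apply/matrixP => k l.
  rewrite TM power_power_adem // summxE; apply: eq_bigr => j _.
  by rewrite mxE TM.
by exists #|{: I}|.-1, f, F; split=> // n k l; rewrite FE mxE.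
Qed.

Lemma chiP_entry d (f : 'I_d.+1 -> I) (F : {rmorphism steenrod p -> 'M[K]_d.+1})
    n k l : bijective f ->
  (forall m i j, F (stP p m) i j = power_entry m (f i) (f j)) ->
  F (chiP p n) k l = conj_entry n (f k) (f l).
Proof.
move=> f_bij FP; elim/ltn_ind: n k l => n IH k l.
have [->|n_gt0] := posnP n.
  by rewrite chiP0 FP power_entry0 conj_entry0.
have mulE a b (G : I -> I -> K) : (forall i j, F b i j = G (f i) (f j)) ->
    (F (stP p a * b)) k l = \sum_u power_entry a (f k) u * G u (f l).
  move=> bE; rewrite rmorphM -mulmxE mxE.
  rewrite [RHS](reindex f) /=; last exact: onW_bij.
  by apply: eq_bigr => m _; rewrite FP bE.
have /(congr1 F) := chiP_sum p n_gt0.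
move=> /(congr1 (fun M : 'M_d.+1 => M k l)).
have := power_conj_sum (f k) (f l) n_gt0.
rewrite big_ord_recl big_mkord big_ord_recl /= !subn0 raddfD raddf0 !mxE.
have -> : \sum_u power_entry 0 (f k) u * conj_entry n u (f l)
    = conj_entry n (f k) (f l).
  rewrite (bigD1 (f k)) //= power_entry0 eqxx mul1r big1 ?addr0 // => u nu.
  by rewrite power_entry0 eq_sym (negPf nu) mul0r.
rewrite stP0 mul1r => eqX.
rewrite raddf_sum summxE.
under eq_bigr => a _.
  rewrite (mulE _ _ (conj_entry (n - bump 0 a)%N)); last first.
    by move=> i j; apply: IH; rewrite ltn_subrL n_gt0.
  over.
by rewrite -[RHS]eqX => /addIr.
Qed.

End TensorPower.

(** * Sums of powers of p *)

Lemma wt_geometric p k : (0 < p)%N -> ((p - 1) * wt p k + 1 = p ^ k)%N.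
Proof.
move=> p_gt0; elim: k => [|k IH]; first by rewrite /wt big_ord0 muln0.
by rewrite wtS expnS -IH; case: (p) p_gt0 => // q _; rewrite subn1 /=; nia.
Qed.

Lemma sum_nseq (F : nat -> nat) m k : (\sum_(i <- nseq m k) F i = m * F k)%N.
Proof. by rewrite big_nseq iter_addn_0 mulnC. Qed.

Lemma digit_powers p A : (1 < p)%N -> exists s : seq nat,
  size s = alpha p A /\ (\sum_(k <- s) p ^ k = A)%N.
Proof.
move=> p_gt1.
suff H m : exists s : seq nat, size s = (\sum_(k < m) (A %/ p ^ k) %% p)%N
    /\ (\sum_(k <- s) p ^ k + A %/ p ^ m * p ^ m = A)%N.
  have [s [sz_s sum_s]] := H A; exists s; split=> //.
  by rewrite -[RHS]sum_s divn_small ?mul0n ?addn0 // ltn_expl.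
elim: m => [|m [s [sz_s sum_s]]].
  by exists [::]; rewrite big_ord0 big_nil divn1 muln1.
exists (nseq ((A %/ p ^ m) %% p) m ++ s); split.
  by rewrite size_cat size_nseq sz_s big_ord_recr addnC.
rewrite big_cat sum_nseq /= -[RHS]sum_s [in RHS](divn_eq (A %/ p ^ m) p).
by rewrite -divnMA -expnSr mulnDl -mulnA -expnS; lia.
Qed.

(** Splitting p^(k+1) into p copies of p^k keeps the sum and lowers the sum of
    the wt k by wt k.+1 - p * wt k = 1, so every smaller value is reached. *)
Lemma split_powers p A (s : seq nat) d : (1 < p)%N ->
  (\sum_(k <- s) p ^ k = A)%N -> (d <= \sum_(k <- s) wt p k)%N ->
  exists s' : seq nat,
    (\sum_(k <- s') p ^ k = A)%N /\ (\sum_(k <- s') wt p k = d)%N.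
Proof.
move=> p_gt1 sum_s /subnK; move eqm: (_ - d)%N => m.
elim: m s sum_s {eqm} => [|m IH] s sum_s wt_s; first by exists s.
have [/allP s0|] := boolP (all (eq_op 0%N) s).
  suff : (\sum_(k <- s) wt p k = 0)%N by rewrite -wt_s addSn.
  by rewrite big1_seq // => k /andP [_ /s0 /eqP <-]; rewrite /wt big_ord0.
rewrite -has_predC => /hasP [[|k] ks _] //.
have /perm_to_rem sE := ks; set t := rem _ _ in sE.
apply: (IH (nseq p k ++ t)).
  by rewrite big_cat sum_nseq -[RHS]sum_s (perm_big _ sE) big_cons /= expnS.
move: wt_s; rewrite (perm_big _ sE) big_cons big_cat sum_nseq /= wtS.
rewrite -(wt_geometric k (ltnW p_gt1)).
by case: (p) p_gt1 => // q _; rewrite subn1 /=; nia.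
Qed.

(** Since p^k = (p - 1) wt k + 1, a list s of exponents with sum of powers A
    satisfies (p - 1) (sum of the wt k) = A - size s.  For the digits of A this
    is A - alpha(A), which is at least (p - 1) (n - A); splitting brings the
    sum of the wt k down to n - A, and wt k.+1 = wt k + p^k. *)
Lemma powers_of_weight p A n : (1 < p)%N -> (A <= n)%N ->
  ((p - 1) * n <= p * A - alpha p A)%N ->
  exists s : seq nat,
    (\sum_(k <- s) p ^ k = A)%N /\ (\sum_(k <- s) wt p k.+1 = n)%N.
Proof.
move=> p_gt1 le_An le_n; have [s [sz_s sum_s]] := digit_powers A p_gt1.
have wtE t :
    (\sum_(k <- t) p ^ k = (p - 1) * (\sum_(k <- t) wt p k) + size t)%N.
  elim: t => [|k t IH]; first by rewrite !big_nil muln0.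
  by rewrite !big_cons IH /= -(wt_geometric k (ltnW p_gt1)) mulnDr; lia.
have [|s' [sum_s' wt_s']] := split_powers (d := n - A) p_gt1 sum_s.
  rewrite -(leq_pmul2l (_ : 0 < p - 1)%N) ?subn_gt0 //.
  have := wtE s; rewrite sum_s sz_s; have := alpha_le A p_gt1.
  by move: le_n; case: (p) p_gt1 => // q _; rewrite subn1 /=; nia.
exists s'; split=> //.
under eq_bigr => k _ do rewrite wtS.
by rewrite big_split /= sum_s' wt_s' subnK.
Qed.

(** * Degrees of the reduced powers and their conjugates *)

Lemma redpow_degD p n (x y : steenrod p) :
  redpow_deg n x -> redpow_deg n y -> redpow_deg n (x + y).
Proof.
move=> [m1 [c1 [s1 [sum1 ->]]]] [m2 [c2 [s2 [sum2 ->]]]].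
exists (m1 + m2)%N.
exists (fun k => match split k with inl i => c1 i | inr i => c2 i end).
exists (fun k => match split k with inl i => s1 i | inr i => s2 i end).
split=> [k|]; first by case: (split k).
rewrite big_split_ord /=; congr (_ + _); apply: eq_bigr => i _.
  by rewrite (unsplitK (inl i)).
by rewrite (unsplitK (inr i)).
Qed.

Lemma redpow_degN p n (x : steenrod p) : redpow_deg n x -> redpow_deg n (- x).
Proof.
move=> [m [c [s [sum_s ->]]]]; exists m, (fun k => - c k), s; split=> //.
by rewrite -sumrN; apply: eq_bigr => k _; rewrite scaleNr.
Qed.

Lemma redpow_deg0 p n : redpow_deg n (0 : steenrod p).
Proof.
exists 0%N, (fun=> 0), (fun=> [::]); split; first by case.
by rewrite big_ord0.
Qed.

Lemma redpow_degMl p n i (x : steenrod p) : redpow_deg n x ->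
  redpow_deg (i + n) (stP p i * x).
Proof.
move=> [m [c [s [sum_s ->]]]]; exists m, c, (fun k => i :: s k); split.
  by move=> k /=; rewrite sum_s.
rewrite mulr_sumr; apply: eq_bigr => k _.
by rewrite big_cons !scale_Fp mulrnAr.
Qed.

Lemma redpow_chiP p n : redpow_deg n (chiP p n).
Proof.
elim/ltn_ind: n => n IH; have [->|n_gt0] := posnP n.
  exists 1%N, (fun=> 1), (fun=> [:: 0%N]); split=> //.
  by rewrite big_ord1 big_seq1 scale1r chiP0.
have := chiP_sum p n_gt0.
rewrite big_nat_recl // stP0 mul1r subn0 => /eqP; rewrite addr_eq0 => /eqP ->.
apply: redpow_degN; rewrite big_nat_cond.
apply: (big_ind (@redpow_deg p n)); [exact: redpow_deg0|exact: redpow_degD|].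
move=> i /andP [lt_in _]; rewrite -[X in redpow_deg X _](subnKC lt_in).
by apply: redpow_degMl; apply: IH; rewrite ltn_subrL.
Qed.

(** * Linear independence *)

(** phi is the matrix coefficient at (w, 0) on a tensor power, where A is the
    sum of the p^(w_i - 1) and n is the degree of w. *)
Lemma power_conj_functional p A n : prime p -> (A <= n)%N ->
  ((p - 1) * n <= p * A - alpha p A)%N ->
  exists e (phi : steenrod p -> 'F_p),
    {morph phi : x y / x + y} /\
    forall i, (i <= n)%N ->
      phi (stP p i * chiP p (n - i)) = (-1) ^+ (e + i) *+ 'C(A, i).
Proof.
move=> p_pr le_An le_n; have p_gt1 := prime_gt1 p_pr.
have [s [sum_s wt_s]] := powers_of_weight p_gt1 le_An le_n.
pose r := size s; have lt_sn (i : 'I_r) : (nth 0%N s i < n)%N.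
  apply: leq_trans le_An; apply: leq_trans (ltn_expl _ p_gt1) _.
  by rewrite -sum_s (big_nth 0%N) big_mkord (bigD1 i) //= leq_addr.
pose w : {ffun 'I_r -> 'I_n.+1} :=
  [ffun i : 'I_r => Ordinal (lt_sn i : (nth 0%N s i).+1 < n.+1)%N].
pose v : {ffun 'I_r -> 'I_n.+1} := [ffun=> ord0].
have degw : deg p w = (deg p v + n)%N.
  rewrite /deg [X in (X + n)%N]big1; last first.
    by move=> i _; rewrite ffunE /wt big_ord0.
  rewrite add0n; transitivity (\sum_(k <- s) wt p k.+1)%N => //.
  rewrite (big_nth 0%N) big_mkord.
  by apply: eq_bigr => i _; rewrite ffunE.
have lt_vw i : (v i < w i)%N by rewrite !ffunE.
have sumw : (\sum_i p ^ (w i).-1 = A)%N.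
  rewrite -sum_s (big_nth 0%N) big_mkord.
  by apply: eq_bigr => i _; rewrite ffunE.
have [d [f [F [f_bij FP]]]] := steenrod_matrix_rep p_pr r n.
have [g fK gK] := f_bij.
exists (\sum_i (w i + v i))%N, (fun x => F x (g w) (g v)).
split=> [x y|i le_in]; first by rewrite raddfD mxE.
rewrite -sumw -(power_conj_top p_pr degw lt_vw le_in).
rewrite rmorphM -mulmxE mxE [RHS](reindex f) /=; last exact: onW_bij.
by apply: eq_bigr => m _; rewrite FP (chiP_entry p_pr _ _ _ f_bij FP) !gK.
Qed.

Theorem proposition1p3 (p n : nat) (p_prime : prime p) (n_ge1 : (1 <= n)%N) :
  (forall i : nat, (lmax p n + 1 <= i <= n)%N ->
     redpow_deg n (stP p i * chiP p (n - i)))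
  /\ (forall c : nat -> 'F_p,
        \sum_(lmax p n + 1 <= i < n.+1) c i *: (stP p i * chiP p (n - i)) = 0 ->
        forall i : nat, (lmax p n + 1 <= i <= n)%N -> c i = 0).
Proof.
split=> [i /andP [_ le_in]|c sum0 i].
  rewrite -[X in redpow_deg X _](subnKC le_in).
  exact/redpow_degMl/redpow_chiP.
have p_gt1 := prime_gt1 p_prime; have [_ lmax_max] := lmaxP p_gt1 n_ge1.
elim/ltn_ind: i => A IH /andP [le_lA le_An].
(* The functional for A kills the terms with index above A, since
   'C(A, i) = 0 for i > A; those below A vanish by induction. *)
have [|e [phi [phiD phiE]]] := power_conj_functional p_prime le_An.
  by rewrite leqNgt; apply/negP => /lmax_max; rewrite leqNgt -addn1 le_lA.
have phi0 : phi 0 = 0 by apply: (addrI (phi 0)); rewrite -phiD !addr0.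
have phiZ a x : phi (a *: x) = a * phi x.
  rewrite scale_Fp -[a in RHS]natr_Zp mulr_natl.
  by elim: (nat_of_ord a) => // m mE; rewrite !mulrS phiD mE.
have := congr1 phi sum0; rewrite phi0 (big_morph phi phiD phi0).
rewrite (bigD1_seq A) ?mem_index_iota ?iota_uniq //=.
  2: by rewrite le_lA ltnS.
rewrite big_nat_cond big1 ?addr0 => [|i /andP [/andP [le_li]]]; last first.
  rewrite ltnS phiZ => le_in neq_iA; rewrite phiE //.
  have [lt_iA|lt_Ai|/eqP] := ltngtP i A; last by rewrite (negPf neq_iA).
    by rewrite IH ?mul0r // le_li.
  by rewrite bin_small // mulr0n mulr0.
rewrite phiZ phiE // binn mulr1n => /eqP.
by rewrite mulf_eq0 expf_eq0 oppr_eq0 oner_eq0 andbF orbF => /eqP.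
Qed.
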